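(* Let $\|\cdot\|$ be the Euclidean norm on $\mathbb{R}^d$, let $L>0$, and let $F:\mathbb{R}^d\to\mathbb{R}^d$ be an arbitrary $L$-Lipschitz operator, i.e. $\|F(\mathbf{u})-F(\mathbf{v})\|\le L\|\mathbf{u}-\mathbf{v}\|$ for all $\mathbf{u},\mathbf{v}\in\mathbb{R}^d$. Suppose that there exist $\rho\in[0,\frac{1}{4L})$ and $\mathbf{u}^*\in\mathcal{U}^*$ such that $$\langle F(\mathbf{u}),\mathbf{u}-\mathbf{u}^*\rangle\ \ge\ -\frac{\rho}{2}\|F(\mathbf{u})\|^2\qquad\text{for all }\mathbf{u}\in\mathbb{R}^d,$$ and fix such $\rho$ and $\mathbf{u}^*$. Given an arbitrary initial point $\mathbf{u}_0\in\mathbb{R}^d$, let the sequences $\{\mathbf{u}_i\}_{i\ge1}$, $\{\bar{\mathbf{u}}_i\}_{i\ge0}$ evolve according to the EG+ algorithm (recalled in the context) with $\beta=\frac12$ and $a_k=\frac{1}{2L}$ for all $k$. Then: (i) all accumulation points of $\{\bar{\mathbf{u}}_k\}_{k\ge0}$ are in $\mathcal{U}^*$; (ii) for all $k\ge1$, $$\frac{1}{k+1}\sum_{i=0}^k\|F(\bar{\mathbf{u}}_i)\|^2\le\frac{2L\|\mathbf{u}_0-\mathbf{u}^*\|^2}{(k+1)(1/(4L)-\rho)}.$$ In particular, $$\min_{0\le i\le k}\|F(\bar{\mathbf{u}}_i)\|^2\le\frac{2L\|\mathbf{u}_0-\mathbf{u}^*\|^2}{(k+1)(1/(4L)-\rho)}$$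 and $$\mathbb{E}_{i\sim\mathrm{Unif}\{0,\dots,k\}}\big[\|F(\bar{\mathbf{u}}_i)\|^2\big]\le\frac{2L\|\mathbf{u}_0-\mathbf{u}^*\|^2}{(k+1)(1/(4L)-\rho)},$$ where $i\sim\mathrm{Unif}\{0,\dots,k\}$ denotes an index $i$ chosen uniformly at random from $\{0,\dots,k\}$.
   Context: $\mathcal{U}^*$ denotes the set of solutions of the unconstrained Stampacchia variational inequality for $F$, i.e. points $\mathbf{u}^*\in\mathbb{R}^d$ with $\langle F(\mathbf{u}^* ),\mathbf{u}-\mathbf{u}^*\rangle\ge0$ for all $\mathbf{u}\in\mathbb{R}^d$; equivalently, $\mathcal{U}^*=\{\mathbf{u}\in\mathbb{R}^d: F(\mathbf{u})=\mathbf{0}\}$. It is assumed nonempty. The EG+ algorithm with parameter $\beta\in(0,1]$ and step sizes $a_k>0$ generates, for $k\ge0$, $$\bar{\mathbf{u}}_k=\mathrm{argmin}_{\mathbf{u}\in\mathbb{R}^d}\Big\{\frac{a_k}{\beta}\langle F(\mathbf{u}_k),\mathbf{u}-\mathbf{u}_k\rangle+\frac12\|\mathbf{u}-\mathbf{u}_k\|^2\Big\}=\mathbf{u}_k-\frac{a_k}{\beta}F(\mathbf{u}_k),$$ $$\mathbf{u}_{k+1}=\mathrm{argmin}_{\mathbf{u}\in\mathbb{R}^d}\Big\{a_k\langle F(\bar{\mathbf{u}}_k),\mathbf{u}-\mathbf{u}_k\rangle+\frac12\|\mathbf{u}-\mathbf{u}_k\|^2\Big\}=\mathbf{u}_k-a_kF(\bar{\mathbf{u}}_k).$$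 *)

(* Defs.v *)
From HB Require Import structures.
From mathcomp Require Import all_boot all_order all_algebra.
From mathcomp Require Import all_classical all_reals all_analysis.

Set Implicit Arguments.
Unset Strict Implicit.
Unset Printing Implicit Defensive.

Import Order.TTheory GRing.Theory Num.Theory.
Import numFieldNormedType.Exports.

Local Open Scope classical_set_scope.
Local Open Scope ring_scope.

Section Euclidean.
Context {R : realType} {d : nat}.
Implicit Types u v w : 'rV[R]_d.

Definition dotp u v : R := \sum_(i < d) u ord0 i * v ord0 i.

(* The library norm on 'rV[R]_d is the sup norm, hence a separate Euclidean
   norm; both induce the (product) topology that 'rV[R]_d carries. *)
Definition enorm u : R := Num.sqrt (dotp u u).

Definition elipschitz (L : R) (F : 'rV[R]_d -> 'rV[R]_d) : Prop :=
  forall u v, enorm (F u - F v) <= L * enorm (u - v).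

Definition SVI_solutions (F : 'rV[R]_d -> 'rV[R]_d) : set 'rV[R]_d :=
  [set us | forall u, 0 <= dotp (F us) (u - us)].

Definition argmin (f : 'rV[R]_d -> R) : set 'rV[R]_d :=
  [set u | forall v, f u <= f v].

(* Both minimised functions are strictly convex quadratics, so each argmin is a
   singleton and membership determines the iterate. *)
Definition EGplus (F : 'rV[R]_d -> 'rV[R]_d) (beta : R) (a : nat -> R)
    (u ubar : nat -> 'rV[R]_d) : Prop :=
  forall k : nat,
    argmin (fun v => a k / beta * dotp (F (u k)) (v - u k)
                     + 2^-1 * enorm (v - u k) ^+ 2) (ubar k) /\
    argmin (fun v => a k * dotp (F (ubar k)) (v - u k)
                     + 2^-1 * enorm (v - u k) ^+ 2) (u k.+1).

End Euclidean.

Definition uniform_upto {R : realType} {disp : measure_display}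
    {T : measurableType disp} (P : probability T R) (k : nat)
    (I : {RV P >-> nat}) : Prop :=
  forall i : nat,
    distribution P I [set i] = (if (i <= k)%N then k.+1%:R^-1 else 0)%:E.

(* Main.v *)
Require Import Defs.
From HB Require Import structures.
From mathcomp Require Import all_boot all_order all_algebra.
From mathcomp Require Import all_classical all_reals all_analysis.
From mathcomp Require Import ring lra.

Set Implicit Arguments.
Unset Strict Implicit.
Unset Printing Implicit Defensive.

Import Order.TTheory GRing.Theory Num.Theory.
Import numFieldNormedType.Exports.

Local Open Scope classical_set_scope.
Local Open Scope ring_scope.

(** Write x for u_k, f for F (u_k), g for F (ubar_k) and a = 1/(2L), so that
ubar_k = x - f/L and u_(k+1) = x - a g.  Expanding the square,

   |u_(k+1) - us|^2 = |x - us|^2 - 2 a <g, x - us> + a^2 |g|^2,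

and the inner product splits along x - us = (ubar_k - us) + f/L.  The weak
variational inequality at ubar_k bounds the first part below by
-(rho/2) |g|^2.  For the second part, since x and ubar_k are f/L apart, the
Lipschitz bound gives |f - g| <= |f|, that is |g|^2 <= 2 <f, g>.  Hence
|u_k - us|^2 drops at each step by at least a (1/(2L) - rho) |g|^2
(lemma [EGplus_step_decrease]), hence by at least a (1/(4L) - rho) |g|^2,
whose coefficient is positive.  Telescoping bounds the partial sums of
|F (ubar_i)|^2 independently of their length (lemma [EGplus_sum_bound]).

The minimum and the uniform expectation are at most, respectively equal to,
the average of the |F (ubar_i)|^2.  The bounded sums also force
F (ubar_k) -> 0, so F vanishes at each accumulation point, F being
continuous (lemma [cluster_zero_lipschitz]). *)

(** * Euclidean inner product *)

Section Euclidean.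
Context {R : realType} {d : nat}.
Implicit Types (u v w x y g us : 'rV[R]_d) (a L rho : R).

Lemma dotpC u v : dotp u v = dotp v u.
Proof. by apply: eq_bigr => i _; rewrite mulrC. Qed.

Lemma dotpDl u v w : dotp (u + v) w = dotp u w + dotp v w.
Proof. by rewrite -big_split; apply: eq_bigr => i _; rewrite !mxE mulrDl. Qed.

Lemma dotpZl a u v : dotp (a *: u) v = a * dotp u v.
Proof. by rewrite mulr_sumr; apply: eq_bigr => i _; rewrite !mxE mulrA. Qed.

Lemma dotpNl u v : dotp (- u) v = - dotp u v.
Proof. by rewrite -scaleN1r dotpZl mulN1r. Qed.

Lemma dotpDr u v w : dotp u (v + w) = dotp u v + dotp u w.
Proof. by rewrite dotpC dotpDl !(dotpC _ u). Qed.

Lemma dotpZr a u v : dotp u (a *: v) = a * dotp u v.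
Proof. by rewrite dotpC dotpZl dotpC. Qed.

Lemma dotpNr u v : dotp u (- v) = - dotp u v.
Proof. by rewrite dotpC dotpNl dotpC. Qed.

Definition dotpE := (dotpDl, dotpDr, dotpNl, dotpNr, dotpZl, dotpZr).

Lemma dotp_ge0 u : 0 <= dotp u u.
Proof. by apply: sumr_ge0 => i _; rewrite -expr2 sqr_ge0. Qed.

Lemma dotp_eq0 u : (dotp u u == 0) = (u == 0).
Proof.
rewrite psumr_eq0; last by move=> i _; rewrite -expr2 sqr_ge0.
apply/allP/eqP => [u0|-> i _]; last by rewrite mxE mulr0 eqxx.
apply/rowP => i; rewrite mxE; apply/eqP.
by have := u0 i (mem_index_enum i); rewrite mulf_eq0 orbb.
Qed.

Lemma enorm_ge0 u : 0 <= enorm u.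
Proof. exact: sqrtr_ge0. Qed.

Lemma sqr_enorm u : enorm u ^+ 2 = dotp u u.
Proof. by rewrite sqr_sqrtr ?dotp_ge0. Qed.

Lemma sqr_enormD_le u v :
  enorm (u + v) ^+ 2 <= 2 * enorm u ^+ 2 + 2 * enorm v ^+ 2.
Proof.
have := dotp_ge0 (u - v).
by rewrite !sqr_enorm !dotpE (dotpC v u); lra.
Qed.

Lemma elipschitz_sqr L (F : 'rV[R]_d -> 'rV[R]_d) x y : elipschitz L F ->
  enorm (F x - F y) ^+ 2 <= L ^+ 2 * enorm (x - y) ^+ 2.
Proof.
move=> FL; rewrite -exprMn lerXn2r ?nnegrE ?enorm_ge0 ?FL//.
exact: le_trans (enorm_ge0 _) (FL x y).
Qed.

(** * One step of the method *)

(** Completing the square, the objective is |v - x + a g|^2 / 2 up to an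
additive constant. *)
Lemma argmin_gradient_step a g x w :
  argmin (fun v => a * dotp g (v - x) + 2^-1 * enorm (v - x) ^+ 2) w ->
  w = x - a *: g.
Proof.
move=> /(_ (x - a *: g)); rewrite [x - _ - x]addrAC subrr add0r => w_min.
apply/eqP; rewrite -subr_eq0 opprD opprK addrA -dotp_eq0 eq_le dotp_ge0 andbT.
move: w_min; move: (w - x) => z; rewrite !sqr_enorm !dotpE (dotpC z g); lra.
Qed.

(** By the Lipschitz bound, the extrapolation from x to y, of length |F x| / L,
changes F by at most |F x|; squaring, |F y|^2 <= 2 <F x, F y>.  This
yields the gain (1/L) |F y|^2 in 2 <F y, x - us>, of which the second order
term (2L)^-1 |F y|^2 consumes one half and the weak inequality at y consumes
rho |F y|^2. *)
Lemma EGplus_step_decrease L (F : 'rV[R]_d -> 'rV[R]_d) rho us x y :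
    0 < L -> elipschitz L F ->
    - (rho / 2) * enorm (F y) ^+ 2 <= dotp (F y) (y - us) ->
    y = x - L^-1 *: F x ->
  (2 * L)^-1 * ((2 * L)^-1 - rho) * enorm (F y) ^+ 2 <=
  enorm (x - us) ^+ 2 - enorm (x - (2 * L)^-1 *: F y - us) ^+ 2.
Proof.
move=> L0 FL weak yE.
have xyE : x - y = L^-1 *: F x by rewrite yE opprB addrC subrK.
have Fxy : enorm (F y) ^+ 2 <= 2 * dotp (F x) (F y).
  have := elipschitz_sqr x y FL.
  rewrite xyE !sqr_enorm !dotpE (dotpC (F y) (F x)).
  by rewrite !mulrA expr2 mulfK ?gt_eqF// divff ?gt_eqF//; lra.
have split_dot :
    dotp (F y) (x - us) = dotp (F y) (y - us) + L^-1 * dotp (F x) (F y).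
  by rewrite (dotpC (F x)) -dotpZr -dotpDr -xyE (addrC (y - us)) subrKA.
rewrite [x - _ - us]addrAC.
move: (x - us) split_dot => z split_dot.
move: Fxy weak; rewrite !sqr_enorm !(dotpDl z) !(dotpDr _ z).
rewrite !dotpNr !dotpNl !dotpZr !dotpZl (dotpC z) split_dot.
set G := dotp (F y) (F y); set D := dotp (F x) _; set W := dotp _ (y - us).
move=> GD WG; rewrite invfM.
have K0 : 0 < L^-1 by rewrite invr_gt0.
move: K0; set K := L^-1 => K0.
(* with these two products the goal becomes linear in the monomials *)
have := ler_wpM2l (ltW K0) WG.
have := ler_wpM2l (sqr_ge0 K) GD.
lra.
Qed.

(** * Accumulation points *)

(** Some v k is both close to p and late enough for F (v k) to be small, and
|F p|^2 <= 2 |F p - F (v k)|^2 + 2 |F (v k)|^2. *)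
Lemma cluster_zero_lipschitz L (F : 'rV[R]_d -> 'rV[R]_d)
    (v : nat -> 'rV[R]_d) p :
    elipschitz L F -> (enorm (F (v k)) ^+ 2) @[k --> \oo] --> 0 ->
  cluster (v @ \oo) p -> F p = 0.
Proof.
move=> FL Fv0 vp; apply/eqP; rewrite -dotp_eq0 -sqr_enorm eq_le sqr_ge0 andbT.
apply/ler_addgt0Pl => e e0; rewrite addr0.
(* r is such that L^2 d r^2 <= e / 4: the balls are those of the sup norm, so
   |p - w|^2 <= d r^2 on the ball of radius r; the + 1 keeps c positive when
   d = 0 *)
pose c := 4 * (L ^+ 2 * d%:R + 1).
have c0 : 0 < c by rewrite mulr_gt0// ltr_wpDl// mulr_ge0// sqr_ge0.
pose r := Num.sqrt (e / c).
have r0 : 0 < r by rewrite sqrtr_gt0 divr_gt0.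
have r2 : r ^+ 2 = e / c by rewrite sqr_sqrtr// ltW// divr_gt0.
have Fv_small : (v @ \oo) [set w | enorm (F w) ^+ 2 < e / 4].
  have e4 : 0 < e / 4 by rewrite divr_gt0.
  move/cvgrPdist_lt : Fv0 => /(_ _ e4); apply: filterS => k /=.
  by rewrite sub0r normrN ger0_norm ?sqr_ge0.
have [w [/= Fw [_ pw]]] := vp _ _ Fv_small (nbhsx_ballx p r r0).
have {}pw : enorm (p - w) ^+ 2 <= d%:R * r ^+ 2.
  rewrite sqr_enorm mulr_natl -[d in leRHS]card_ord -sumr_const.
  apply: ler_sum => i _; rewrite !mxE -expr2 -real_normK ?num_real//.
  by rewrite lerXn2r ?nnegrE ?normr_ge0 ?ltW//; exact: pw.
have := elipschitz_sqr p w FL.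
have := sqr_enormD_le (F p - F w) (F w); rewrite subrK.
have : L ^+ 2 * enorm (p - w) ^+ 2 <= e / 4.
  apply: (@le_trans _ _ (L ^+ 2 * (d%:R * r ^+ 2))).
    by rewrite ler_wpM2l ?sqr_ge0.
  rewrite r2 mulrA [leRHS](_ : _ = (c / 4) * (e / c)).
    by rewrite ler_wpM2r ?(divr_ge0 (ltW e0) (ltW c0))//; rewrite /c; lra.
  by field; rewrite gt_eqF.
lra.
Qed.

End Euclidean.

(** * Telescoping over the iterations *)

Section Rate.
Context {R : realType} {d : nat} (L rho : R) (F : 'rV[R]_d -> 'rV[R]_d).
Context (us : 'rV[R]_d) (u ubar : nat -> 'rV[R]_d).
Context (L_gt0 : 0 < L) (F_lipschitz : elipschitz L F).
Context (rho_lt : rho < 1 / (4 * L)).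
Context (weak_MVI : forall v : 'rV[R]_d,
  - (rho / 2) * enorm (F v) ^+ 2 <= dotp (F v) (v - us)).
Context (u_EGplus : EGplus F (1 / 2) (fun=> 1 / (2 * L)) u ubar).

(** The right-hand side is free of n, so the residuals are summable; this
gives both the rate and their convergence to 0. *)
Lemma EGplus_sum_bound n :
  \sum_(0 <= i < n) enorm (F (ubar i)) ^+ 2 <=
  2 * L * enorm (u 0 - us) ^+ 2 / (1 / (4 * L) - rho).
Proof.
have gap0 : 0 < 1 / (4 * L) - rho by rewrite subr_gt0.
have decrease k : (2 * L)^-1 * (1 / (4 * L) - rho) * enorm (F (ubar k)) ^+ 2 <=
    enorm (u k - us) ^+ 2 - enorm (u k.+1 - us) ^+ 2.
  have [/argmin_gradient_step ubarE /argmin_gradient_step ->] := u_EGplus k.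
  rewrite [in leRHS]div1r.
  (* a / beta = 1 / L turns the first step into the one of the decrease lemma *)
  have half : 1 / (2 * L) / (1 / 2) = L^-1 by field; rewrite gt_eqF.
  rewrite half in ubarE.
  apply: le_trans (EGplus_step_decrease L_gt0 F_lipschitz (weak_MVI _) ubarE).
  rewrite ler_wpM2r ?sqr_ge0// ler_wpM2l ?invr_ge0 ?mulr_ge0 ?ltW//.
  have L1 : 0 < L^-1 by rewrite invr_gt0.
  by rewrite div1r !invfM; lra.
have telescoped : (2 * L)^-1 * (1 / (4 * L) - rho) *
    (\sum_(0 <= i < n) enorm (F (ubar i)) ^+ 2) <=
    enorm (u 0 - us) ^+ 2.
  rewrite mulr_sumr (le_trans (ler_sum_nat (fun k _ => decrease k)))//.
  rewrite (@telescope_sumr_eq _ _ _ (fun k => - enorm (u k - us) ^+ 2))//.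
    by rewrite opprK addrC lerBlDr lerDl sqr_ge0.
  by move=> k _; rewrite opprK addrC.
rewrite ler_pdivlMr// mulrC -ler_pdivrMl ?mulr_gt0//.
by rewrite mulrA.
Qed.

Lemma EGplus_residual_cvg0 : enorm (F (ubar k)) ^+ 2 @[k --> \oo] --> 0.
Proof.
apply: cvg_series_cvg_0; apply: nondecreasing_is_cvgn.
  by apply: nondecreasing_series => i _ _; exact: sqr_ge0.
by eexists => _ [n _ <-]; exact: EGplus_sum_bound.
Qed.

End Rate.

(** * Averages *)

Lemma bigmin_le_average {R : realType} (c : nat -> R) k :
  \big[Num.min/c 0]_(0 <= i < k.+1) c i <=
  1 / k.+1%:R * \sum_(0 <= i < k.+1) c i.
Proof.
rewrite div1r ler_pdivlMl// mulr_natl !big_mkord.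
set m := \big[_/_]_(_ < _) _; rewrite -[k.+1 in leLHS]card_ord -sumr_const.
by apply: ler_sum => i _; exact: (bigmin_le _ i (fun j : 'I_k.+1 => c j)).
Qed.

(** The integral is taken on the side of the law of I, over the countable
partition of nat into singletons. *)
Lemma expectation_uniform_upto {R : realType} (c : nat -> R) k
    (disp : measure_display) (T : measurableType disp) (P : probability T R)
    (I : {RV P >-> nat}) : (forall i, 0 <= c i) -> uniform_upto k I ->
  ('E_P[fun t => c (I t)] = (1 / k.+1%:R * \sum_(0 <= i < k.+1) c i)%:E)%E.
Proof.
move=> c0 unifI; rewrite unlock.
have cE0 i : (0 <= (c i)%:E)%E by rewrite lee_fin.
rewrite -(ge0_integral_distribution I (f := fun i => (c i)%:E))//.
have -> : [set: nat] = \bigcup_i [set i].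
  by apply/esym/seteqP; split => // i _; exists i.
rewrite ge0_integral_bigcup//; last first.
  by move=> i j _ _ [n [-> ->]].
pose mass i := ((c i)%:E * distribution P I [set i])%E.
rewrite (eq_eseriesr (g := mass)); last first.
  move=> i _; rewrite /mass -integral_cst//; apply: eq_integral => j.
  by rewrite inE => ->.
rewrite (nneseries_split 0 k.+1) => [|i _]; last by rewrite mule_ge0.
rewrite add0n [X in (_ + X)%E]eseries0 ?adde0; last first.
  by move=> i ki _; rewrite /mass unifI leqNgt ki mule0.
rewrite mulr_sumr -sumEFin; apply: eq_big_nat => i /= ik.
by rewrite /mass unifI -ltnS ik -EFinM mulrC div1r.
Qed.

Theorem theorem3p2 (R : realType) (d : nat) (L : R)
    (F : 'rV[R]_d -> 'rV[R]_d) (rho : R) (us : 'rV[R]_d)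
    (u ubar : nat -> 'rV[R]_d)
    (L_gt0 : 0 < L)
    (F_lipschitz : elipschitz L F)
    (rho_ge0 : 0 <= rho) (rho_lt : rho < 1 / (4 * L))
    (us_sol : SVI_solutions F us)
    (weak_MVI : forall v : 'rV[R]_d,
        - (rho / 2) * enorm (F v) ^+ 2 <= dotp (F v) (v - us))
    (u_EGplus : EGplus F (1 / 2) (fun=> 1 / (2 * L)) u ubar) :
  cluster (ubar @ \oo) `<=` SVI_solutions F /\
  forall k : nat, (1 <= k)%N ->
    [/\ 1 / k.+1%:R * (\sum_(0 <= i < k.+1) enorm (F (ubar i)) ^+ 2)
          <= 2 * L * enorm (u 0%N - us) ^+ 2
             / (k.+1%:R * (1 / (4 * L) - rho)),
        \big[Num.min/enorm (F (ubar 0%N)) ^+ 2]_(0 <= i < k.+1)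
            enorm (F (ubar i)) ^+ 2
          <= 2 * L * enorm (u 0%N - us) ^+ 2
             / (k.+1%:R * (1 / (4 * L) - rho))
      & forall (disp : measure_display) (T : measurableType disp)
               (P : probability T R) (I : {RV P >-> nat}),
          uniform_upto k I ->
          ('E_P[(fun t => (enorm (F (ubar (I t))) ^+ 2)%R)]
            <= (2 * L * enorm (u 0%N - us) ^+ 2
                / (k.+1%:R * (1 / (4 * L) - rho)))%:E)%E].
Proof.
split=> [p p_cluster v /=|k _].
  have cvg0 := EGplus_residual_cvg0 L_gt0 F_lipschitz rho_lt weak_MVI u_EGplus.
  rewrite (cluster_zero_lipschitz F_lipschitz cvg0 p_cluster).
  by rewrite /dotp big1// => i _; rewrite mxE mul0r.
have average : 1 / k.+1%:R * (\sum_(0 <= i < k.+1) enorm (F (ubar i)) ^+ 2)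
    <= 2 * L * enorm (u 0%N - us) ^+ 2 / (k.+1%:R * (1 / (4 * L) - rho)).
  rewrite div1r invfM mulrCA ler_wpM2l ?invr_ge0//.
  exact: EGplus_sum_bound.
split=> // [|disp T P I unifI].
  exact: le_trans (bigmin_le_average (fun i => enorm (F (ubar i)) ^+ 2) k) _.
pose c i := enorm (F (ubar i)) ^+ 2.
rewrite (expectation_uniform_upto (c := c) _ unifI).
  by rewrite lee_fin.
by move=> i; exact: sqr_ge0.
Qed.
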